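(* Let $G$ be a finite weakly connected digraph with $w(G)=0$. Then there is a unique epimorphism $\varphi: G\to P_{d(G)}$, where $P_{d(G)}$ is the directed path with $d(G)$ arcs.
   Context: A digraph is a pair $G=(V,E)$ with $V$ a finite set and $E\subseteq V\times V$ (loops are allowed, multiple arcs are not). For an arc $(u,v)\in E$, $u$ is its initial vertex and $v$ its end vertex. The directed path $P_n$ ($n\ge 0$) of length $n$ is the digraph with vertex set $\{0,1,\dots,n\}$ and arcs $(0,1),(1,2),\dots,(n-1,n)$. A route $R=(S,\sigma)$ of length $n\ge 0$ in $G$ consists of a sequence of vertices $S=(v_0,\dots,v_n)$ and a sequence $\sigma=(\sigma_1,\dots,\sigma_n)\in\{1,-1\}^n$ such that, for each $i=1,\dots,n$, $(v_{i-1},v_i)\in E$ if $\sigma_i=1$ and $(v_i,v_{i-1})\in E$ if $\sigma_i=-1$. Its weight is $\sigma(R)=\sum_{i=1}^n\sigma_i$. The route is closed if $v_0=v_n$. $G$ is weakly connected if any two vertices are joined by a route. The weight of $G$ is $w(G)=\gcd(W)$, where $W$ is the set of positive integers $n$ such that some closed route $R$ in $G$ has $\sigma(R)=n$; if $W=\emptyset$, then $w(G)=0$. The diameter $d(G)$ is the maximal weight of routes in $G$. A homomorphism of digraphs $G_1\to G_2$ is a map sending vertices to vertices and arcs to arcs, compatible with taking initial vertices and end vertices of arcs. An epimorphism is a homomorphism that is surjective (on vertices and on arcs). *)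

(* Defs.v *)
From mathcomp Require Import all_boot all_order all_algebra.
From mathcomp Require Import boolp classical_sets.
Set Implicit Arguments.
Unset Strict Implicit.
Unset Printing Implicit Defensive.
Import Order.TTheory GRing.Theory Num.Theory.
Local Open Scope ring_scope.

(* Loops are allowed; [arc] being a relation, there are no multiple arcs. *)
Record digraph := Digraph { vertex :> finType; arc : rel vertex }.

Definition dipath (n : nat) : digraph :=
  @Digraph 'I_n.+1 (fun i j => (j == i.+1 :> nat)%N).

(* The sign sigma_(i+1) of the step from v_i to v_(i+1) is [route_sign i]:
   [widen_ord (leqnSn n) i] and [lift ord0 i] are i and i + 1 in 'I_n.+1. *)
Record route (G : digraph) := Route {
  route_length : nat;
  route_vertex : 'I_route_length.+1 -> G;
  route_sign : 'I_route_length -> int;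
  route_signP : forall i, route_sign i = 1 \/ route_sign i = -1;
  route_forward : forall i, route_sign i = 1 ->
    arc (route_vertex (widen_ord (leqnSn route_length) i))
        (route_vertex (lift ord0 i));
  route_backward : forall i, route_sign i = -1 ->
    arc (route_vertex (lift ord0 i))
        (route_vertex (widen_ord (leqnSn route_length) i))
}.

Arguments route_vertex {G} R _ : rename.
Arguments route_sign {G} R _ : rename.

Section Routes.
Variable G : digraph.

Definition route_source (R : route G) : G := route_vertex R ord0.
Definition route_target (R : route G) : G := route_vertex R ord_max.

Definition route_weight (R : route G) : int :=
  \sum_(i < route_length R) route_sign R i.

Definition route_closed (R : route G) : Prop :=
  route_source R = route_target R.

Definition weakly_connected : Prop :=
  forall u v : G, exists R : route G,
    route_source R = u /\ route_target R = v.

Definition closed_weights : set nat :=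
  [set n | (0 < n)%N /\
     exists R : route G, route_closed R /\ route_weight R = n%:Z].

End Routes.

Definition is_gcd (W : set nat) (d : nat) : Prop :=
  (forall n, W n -> d %| n)%N /\
  (forall d', (forall n, W n -> d' %| n) -> d' %| d)%N.

(* W may be infinite. For W empty this is 0, see [gcd_set0]. *)
Definition gcd_set (W : set nat) : nat := xget 0%N (is_gcd W).

Definition digraph_weight (G : digraph) : nat := gcd_set (closed_weights G).

Definition is_diameter (G : digraph) (d : nat) : Prop :=
  (exists R : route G, route_weight R = d%:Z) /\
  (forall R : route G, route_weight R <= d%:Z).

(* A maximal weight is nonnegative because of the routes of length 0. The
   value 0 is a default when the weights of routes are unbounded (or when G
   has no vertex). An epimorphism onto a directed path bounds the weights of
   routes, so for nonempty G it excludes the default case. *)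
Definition diameter (G : digraph) : nat := xget 0%N (is_diameter G).

(* As there are no multiple arcs, a homomorphism is determined by its
   action on vertices, the arc (u, v) being sent to (phi u, phi v). *)
Definition is_hom (G1 G2 : digraph) (phi : {ffun G1 -> G2}) : Prop :=
  forall u v : G1, arc u v -> arc (phi u) (phi v).

Definition is_epi (G1 G2 : digraph) (phi : {ffun G1 -> G2}) : Prop :=
  [/\ is_hom phi,
      forall x : G2, exists u : G1, phi u = x
    & forall x y : G2, arc x y ->
        exists u v : G1, [/\ arc u v, phi u = x & phi v = y] ].

Lemma is_gcd_uniq (W : set nat) d d' : is_gcd W d -> is_gcd W d' -> d = d'.
Proof.
move=> [h1 h2] [h1' h2']; apply/eqP; rewrite eqn_dvd.
by apply/andP; split; [apply: h2'|apply: h2].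
Qed.

Lemma is_gcd_ex (W : set nat) : exists d, is_gcd W d.
Proof.
pose P g := exists s : seq nat,
  [/\ (forall x, x \in s -> W x), foldr gcdn 0%N s = g & (0 < g)%N].
have [[x [Wx x0]]|nW] := pselect (exists x, W x /\ (0 < x)%N); last first.
  exists 0%N; split=> // n Wn; rewrite dvd0n; case: n Wn => // n Wn.
  by case: nW; exists n.+1.
have exP : exists g, `[< P g >].
  exists x; apply/asboolP; exists [:: x]; split=> //=; last by rewrite gcdn0.
  by move=> y; rewrite inE => /eqP ->.
case: (ex_minnP exP) => g /asboolP[s [sW sg g0]] gmin.
exists g; split=> [n Wn|d' d'W].
  have : (g <= gcdn n g)%N.
    apply/gmin/asboolP; exists (n :: s); split=> /=; last 2 first.
    - by rewrite sg.
    - by rewrite gcdn_gt0 g0 orbT.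
    by move=> y; rewrite inE => /orP[/eqP ->|/sW].
  move=> le_g; have /eqP <- : gcdn n g == g.
    by rewrite eqn_leq le_g andbT dvdn_leq // dvdn_gcdr.
  exact: dvdn_gcdl.
rewrite -sg; elim: (s) sW => [|y t IH] sW /=; first exact: dvdn0.
rewrite dvdn_gcd d'W ?IH //; last by apply: sW; rewrite mem_head.
by move=> z zt; apply: sW; rewrite inE zt orbT.
Qed.

Lemma gcd_setP (W : set nat) : is_gcd W (gcd_set W).
Proof. by have [d Wd] := is_gcd_ex W; exact: (xgetI 0%N Wd). Qed.

Lemma gcd_set0 : gcd_set set0 = 0%N.
Proof. by apply: (is_gcd_uniq (gcd_setP _)); split=> // d' _; rewrite dvdn0. Qed.

Lemma diameterE (G : digraph) d : is_diameter G d -> diameter G = d.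
Proof.
move=> Gd; have [[R RE] Rle] := xgetI 0%N Gd.
have [[R' R'E] R'le] := Gd; apply/eqP; rewrite eqn_leq -!lez_nat.
by rewrite -{1}RE R'le -R'E Rle.
Qed.

(* Main.v *)
From mathcomp Require Import all_boot.
From mathcomp Require Import all_order all_algebra.
From mathcomp Require Import boolp.
From mathcomp Require Import zify.
Require Import Defs.

Set Implicit Arguments.
Unset Strict Implicit.
Unset Printing Implicit Defensive.
Import Order.TTheory GRing.Theory Num.Theory.

(** A homomorphism from [G] to a directed path is a potential: a function on
    the vertices that grows by exactly 1 along every arc. The weight of a route
    is then the difference of the potential between its ends.

    Existence: since [G] has weight 0, closed routes have weight 0, so all
    routes from a base vertex to a given vertex have the same weight; as a
    function of that vertex this weight is a potential
    ([exists_potential]). Shift it so that its minimum is 0, and let [M] be a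
    vertex where it is maximal. By connectedness its maximum is the weight of
    a route, and it bounds the weights of all routes, so it is the diameter of
    [G] ([potential_diameter]). A route from the minimum to the maximum moves
    by steps of 1, hence crosses each level upwards, along an arc of [G]
    ([walk_crosses_level]): the potential is onto the vertices and the arcs of
    the path.

    Uniqueness: on a weakly connected digraph two potentials differ by a
    constant. Both take values between 0 and the diameter, and the first one attains
    these two bounds, so the constant is 0. *)

(** * Routes as inductive walks *)

Section Walks.
Variable G : digraph.

(** [walk v u z] says that some route of weight [z] goes from [u] to [v]. This
    inductive form of routes makes concatenation and reversal immediate. *)
Inductive walk (v : G) : G -> int -> Prop :=
| walk_nil : walk v v 0%R
| walk_forward u w z : arc u w -> walk v w z -> walk v u (1 + z)%R
| walk_backward u w z : arc w u -> walk v w z -> walk v u (-1 + z)%R.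

Lemma walk_cat u v w x y : walk v u x -> walk w v y -> walk w u (x + y)%R.
Proof.
move=> uv vw; elim: uv => [|{}u u' z e _ IH|{}u u' z e _ IH].
- by rewrite add0r.
- by rewrite -addrA; apply: walk_forward IH.
- by rewrite -addrA; apply: walk_backward IH.
Qed.

Lemma walk_rev u v x : walk v u x -> walk u v (- x)%R.
Proof.
elim=> [|{}u u' z e _ IH|{}u u' z e _ IH].
- by rewrite oppr0; exact: walk_nil.
- rewrite opprD addrC; apply: walk_cat IH _.
  by rewrite -[(-1)%R]addr0; apply: walk_backward e (walk_nil _).
- rewrite opprD opprK addrC; apply: walk_cat IH _.
  by rewrite -[1%R]addr0; apply: walk_forward e (walk_nil _).
Qed.

Lemma widen_lift0 n (i : 'I_n) :
  widen_ord (leqnSn n.+1) (lift ord0 i) = lift ord0 (widen_ord (leqnSn n) i).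
Proof. exact: val_inj. Qed.

Lemma route_walk (R : route G) :
  walk (route_target R) (route_source R) (route_weight R).
Proof.
rewrite /route_target /route_source /route_weight.
case: R => n V S /=; elim: n V S => [|n IH] V S sgn fwd bwd.
  by rewrite big_ord0 (ord1 ord_max); exact: walk_nil.
have tail : walk (V ord_max) (V (lift ord0 ord0))
                 (\sum_(i < n) S (lift ord0 i))%R.
  rewrite (_ : ord_max = lift ord0 ord_max); last exact: val_inj.
  apply: (IH (fun i => V (lift ord0 i)) (fun i => S (lift ord0 i))) => i.
  - exact: sgn.
  - by move/fwd; rewrite widen_lift0.
  - by move/bwd; rewrite widen_lift0.
have -> : ord0 = widen_ord (leqnSn n.+1) ord0 by exact: val_inj.
rewrite big_ord_recl; case: (sgn ord0) => s0; rewrite s0.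
- exact: walk_forward (fwd _ s0) tail.
- exact: walk_backward (bwd _ s0) tail.
Qed.

Lemma route_cons (u : G) (s : int) (R : route G) :
    s = 1%R \/ s = (-1)%R ->
    (s = 1%R -> arc u (route_source R)) ->
    (s = (-1)%R -> arc (route_source R) u) ->
  exists R' : route G, [/\ route_source R' = u,
    route_target R' = route_target R
    & route_weight R' = (s + route_weight R)%R].
Proof.
rewrite /route_source; case: R => n V S sgn fwd bwd /= s1 su us.
pose V' (i : 'I_n.+2) := oapp V u (unlift ord0 i).
pose S' (i : 'I_n.+1) := oapp S s (unlift ord0 i).
have V'0 : V' ord0 = u by rewrite /V' unlift_none.
have V'S i : V' (lift ord0 i) = V i by rewrite /V' liftK.
have S'0 : S' ord0 = s by rewrite /S' unlift_none.
have S'S i : S' (lift ord0 i) = S i by rewrite /S' liftK.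
have w0 : widen_ord (leqnSn n.+1) ord0 = ord0 by exact: val_inj.
have sgn' i : S' i = 1%R \/ S' i = (-1)%R.
  by case: (unliftP ord0 i) => [j|] ->; rewrite ?S'0 ?S'S.
have fwd' i : S' i = 1%R ->
    arc (V' (widen_ord (leqnSn n.+1) i)) (V' (lift ord0 i)).
  case: (unliftP ord0 i) => [j|] ->; rewrite V'S.
  - by rewrite widen_lift0 S'S V'S => /fwd.
  - by rewrite w0 S'0 V'0.
have bwd' i : S' i = (-1)%R ->
    arc (V' (lift ord0 i)) (V' (widen_ord (leqnSn n.+1) i)).
  case: (unliftP ord0 i) => [j|] ->; rewrite V'S.
  - by rewrite widen_lift0 S'S V'S => /bwd.
  - by rewrite w0 S'0 V'0.
exists (Route sgn' fwd' bwd'); split=> //.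
  rewrite /route_target /=.
  by rewrite (_ : ord_max = lift ord0 ord_max) ?V'S //; exact: val_inj.
rewrite /route_weight /= big_ord_recl S'0; congr (_ + _)%R.
by apply: eq_bigr => i _; rewrite S'S.
Qed.

Lemma walk_route u v z : walk v u z -> exists R : route G,
  [/\ route_source R = u, route_target R = v & route_weight R = z].
Proof.
elim=> [|{}u w {}z e _ [R [Rw Rv Rz]]|{}u w {}z e _ [R [Rw Rv Rz]]].
- pose S (i : 'I_0) : int := 0%R.
  have sgn i : S i = 1%R \/ S i = (-1)%R by case: i.
  have fwd i : S i = 1%R -> arc v v by case: i.
  have bwd i : S i = (-1)%R -> arc v v by case: i.
  exists (@Route G 0 (fun=> v) S sgn fwd bwd); split=> //.
  by rewrite /route_weight /= big_ord0.
- have [|_|//|R' [? R'v R'z]] := @route_cons u 1%R R; first by left.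
    by rewrite Rw.
  by exists R'; split=> //; rewrite ?R'v ?R'z ?Rz.
- have [|//|_|R' [? R'v R'z]] := @route_cons u (-1)%R R; first by right.
    by rewrite Rw.
  by exists R'; split=> //; rewrite ?R'v ?R'z ?Rz.
Qed.

Lemma weakly_connected_walk (u v : G) :
  weakly_connected G -> exists z, walk v u z.
Proof.
move=> conn; have [R [Ru Rv]] := conn u v.
by exists (route_weight R); rewrite -Ru -Rv; exact: route_walk.
Qed.

(** A gcd equal to 0 leaves no positive closed weight, and reversing a closed
    route negates its weight. *)
Lemma closed_walk_weight0 u z : digraph_weight G = 0 -> walk u u z -> z = 0%R.
Proof.
move=> G0.
have no_pos n : ~ walk u u n.+1%:Z.
  move=> /walk_route [R [Ru Rv Rn]].
  have [/(_ n.+1) dvd0 _] := gcd_setP (closed_weights G).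
  rewrite -/(digraph_weight G) G0 dvd0n in dvd0.
  suff: n.+1 == 0 by [].
  by apply: dvd0; split=> //; exists R; rewrite /route_closed Ru Rv.
case: z => [[|n]|n] // uu; first by case: (no_pos n).
by case: (no_pos n); have := walk_rev uu; rewrite NegzE opprK.
Qed.

Lemma walk_weight_unique u v x y :
  digraph_weight G = 0 -> walk v u x -> walk v u y -> x = y.
Proof.
move=> G0 ux uy; apply/eqP; rewrite -subr_eq0; apply/eqP.
exact: closed_walk_weight0 (walk_cat ux (walk_rev uy)).
Qed.

(** * Potentials *)

Definition potential (p : G -> nat) := forall u v, arc u v -> p v = (p u).+1.

(** Measuring every vertex by the weight of the routes from [r0] gives an
    integer potential; subtracting its minimum makes it a natural number and
    provides a vertex of value 0. *)
Lemma exists_potential (r0 : G) :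
    weakly_connected G -> digraph_weight G = 0 ->
  exists p : G -> nat, potential p /\ exists r, p r = 0.
Proof.
move=> conn G0.
have [q qP] := choice (fun v => weakly_connected_walk r0 v conn).
have q_arc u v : arc u v -> q v = (q u + 1)%R.
  move=> e; apply: (walk_weight_unique G0 (qP v)); apply: walk_cat (qP u) _.
  by rewrite -[1%R]addr0; apply: walk_forward e (walk_nil _).
have [r _ r_min] := @arg_minP _ _ _ r0 xpredT q isT.
exists (fun v => `|q v - q r|%N); split; last by exists r; rewrite subrr.
move=> u v /q_arc ->; have := r_min u isT; lia.
Qed.

Section Potential.
Variable p : G -> nat.
Hypothesis p_pot : potential p.

Lemma walk_weight_potential u v z :
  walk v u z -> z = ((p v)%:Z - (p u)%:Z)%R.
Proof.
elim=> [|{}u w {}z e _ ->|{}u w {}z e _ ->]; first by rewrite subrr.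
- by have := p_pot e; lia.
- by have := p_pot e; lia.
Qed.

(** A discrete intermediate value theorem: the first step of the walk that
    leaves the levels up to [k] goes from [k] to [k + 1], so it follows an
    arc forwards. *)
Lemma walk_crosses_level u v z k :
  walk v u z -> p u <= k < p v -> exists a b, arc a b /\ p a = k.
Proof.
elim=> [|{}u w {}z e _ IH|{}u w {}z e _ IH] kP; first by lia.
- have pw := p_pot e; case: (leqP (p w) k) => kw; first by apply: IH; lia.
  by exists u, w; split=> //; lia.
- by have pw := p_pot e; apply: IH; lia.
Qed.

(** The weight of a route is the difference of [p] between its ends: at most
    [p M], and equal to it for a route from [r] to [M]. *)
Lemma potential_diameter r M :
    weakly_connected G -> p r = 0 -> (forall u, p u <= p M) ->
  diameter G = p M.
Proof.
move=> conn pr pM; apply: diameterE; split.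
  have [z rM] := weakly_connected_walk r M conn.
  have [R [_ _ Rz]] := walk_route rM.
  by exists R; rewrite Rz (walk_weight_potential rM) pr subr0.
move=> R; rewrite (walk_weight_potential (route_walk R)).
by have := pM (route_target R); lia.
Qed.

End Potential.
End Walks.

(** * Epimorphisms onto a directed path *)

Lemma hom_dipath_potential (G : digraph) n (phi : {ffun G -> dipath n}) :
  is_hom phi -> potential (fun u => phi u : nat).
Proof. by move=> phi_hom u v /phi_hom /eqP. Qed.

Theorem theorem1p7 (G : digraph) (G_nonempty : (0 < #|vertex G|)%N)
    (G_conn : weakly_connected G) (G_weight0 : digraph_weight G = 0%N) :
  exists! phi : {ffun G -> dipath (diameter G)}, is_epi phi.
Proof.
have [r0 _] := card_gt0P G_nonempty.
have [p [p_pot [r pr]]] := exists_potential r0 G_conn G_weight0.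
have [M _ M_max] := @arg_maxnP _ r0 xpredT p isT.
have p_le u : p u <= p M by exact: M_max.
rewrite (potential_diameter p_pot G_conn pr p_le).
have cross k : k < p M -> exists a b, arc a b /\ p a = k.
  have [z rM] := weakly_connected_walk r M G_conn.
  by move=> kM; apply: (walk_crosses_level p_pot rM); rewrite pr.
pose phi : {ffun G -> dipath (p M)} := [ffun u => inord (p u) : 'I_(p M).+1].
have phiE u : phi u = p u :> nat by rewrite ffunE inordK // ltnS.
exists phi; split; first split.
- by move=> u v /p_pot e; apply/eqP; rewrite !phiE.
(* The top vertex of the path has no outgoing arc, so it is reached apart. *)
- move=> x; have := leq_ord x; rewrite leq_eqVlt => /predU1P [xM|/cross].
    by exists M; apply: val_inj; rewrite /= phiE xM.
  by case=> a [b [_ pa]]; exists a; apply: val_inj; rewrite /= phiE pa.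
- move=> x y /eqP xy.
  have /cross [a [b [ab pa]]] : x < p M by rewrite -ltnS -xy ltn_ord.
  exists a, b; split=> //; apply: val_inj; rewrite /= phiE ?pa //.
  by rewrite (p_pot _ _ ab) pa xy.
move=> psi [/hom_dipath_potential psi_pot _ _].
have shift u : psi u = psi r + p u :> nat.
  have [z ru] := weakly_connected_walk r u G_conn.
  have := walk_weight_potential p_pot ru.
  by have := walk_weight_potential psi_pot ru; rewrite pr /=; lia.
(* [psi M] is [psi r + p M] and cannot exceed [p M]. *)
have psi_r : psi r = 0 :> nat by have := leq_ord (psi M); rewrite shift; lia.
by apply/ffunP => u; apply: val_inj; rewrite /= phiE shift psi_r.
Qed.
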